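(* Let $f:\mathbb{R}^d\to\mathbb{R}$ be continuously differentiable and satisfy $RC(\mu,\lambda)$, and suppose the parameters $(\alpha,\beta,\gamma)$ satisfy $$0<\gamma<\frac{(1+\beta)(1+\sqrt{1-\mu\lambda})}{\lambda},\qquad 0<\alpha<\frac{2(1+\beta)(1+\sqrt{1-\mu\lambda})}{\lambda}-2\gamma,\qquad -1<\beta<1.$$ Then the existence of a (real symmetric) positive definite matrix $\mathbf{P}\succ0$, $\mathbf{P}\in\mathbb{R}^{3\times3}$, and a scalar $\rho\in(0,1)$ solving the linear matrix inequality $$\begin{bmatrix}\mathbf{C}&\mathbf{D}\\\mathbf{0}&1\end{bmatrix}^\top\mathbf{M}\begin{bmatrix}\mathbf{C}&\mathbf{D}\\\mathbf{0}&1\end{bmatrix}+\begin{bmatrix}\mathbf{A}^\top\mathbf{P}\mathbf{A}-\rho^2\mathbf{P}&\mathbf{A}^\top\mathbf{P}\mathbf{B}\\\mathbf{B}^\top\mathbf{P}\mathbf{A}&\mathbf{B}^\top\mathbf{P}\mathbf{B}\end{bmatrix}\preceq0$$ is equivalent to the quadratic polynomial inequality $$P(x)=\Gamma_2x^2+\Gamma_1x+\Gamma_0<0$$ holding for all $x=\cos\omega\in[-1,1]$, where $$\begin{aligned}\Gamma_2&=4(\gamma-\mu\beta),\\ \Gamma_1&=2\lambda\gamma(\alpha+\gamma)-2(1+\beta)(\alpha+2\gamma)+2\mu(1+\beta)^2,\\ \Gamma_0&=-\lambda(\alpha^2+2\alpha\gamma+2\gamma^2)+2\alpha(1+\beta)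+4\gamma\beta-2\mu(1+\beta^2).\end{aligned}$$
   Context: Regularity Condition: for constants $\mu,\lambda>0$ (necessarily $\mu\lambda\le1$), $f$ satisfies $RC(\mu,\lambda)$ with local minimizer $\boldsymbol{x}_*$ if $\langle\nabla f(\boldsymbol{x}),\boldsymbol{x}-\boldsymbol{x}_*\rangle\ge\frac{\mu}{2}\|\nabla f(\boldsymbol{x})\|^2+\frac{\lambda}{2}\|\boldsymbol{x}-\boldsymbol{x}_*\|^2$ for all $\boldsymbol{x}\in\mathbb{R}^d$. The matrices are those of the state-space model (with state $(\boldsymbol{x}_k,\boldsymbol{x}_{k-1},\nabla f(\boldsymbol{x}_{k-1}))$, input $\nabla f(\boldsymbol{x}_k)$, output $\boldsymbol{x}_k$) of the algorithm $\boldsymbol{x}_{k+1}=(1+\beta)\boldsymbol{x}_k-\beta\boldsymbol{x}_{k-1}-(\alpha+\gamma)\nabla f(\boldsymbol{x}_k)+\gamma\nabla f(\boldsymbol{x}_{k-1})$, namely $$\mathbf{A}=\begin{bmatrix}1+\beta&-\beta&\gamma\\1&0&0\\0&0&0\end{bmatrix},\quad\mathbf{B}=\begin{bmatrix}-(\alpha+\gamma)\\0\\1\end{bmatrix},\quad\mathbf{C}=\begin{bmatrix}1&0&0\end{bmatrix},\quad\mathbf{D}=0,\quad\mathbf{M}=\begin{bmatrix}-\lambda&1\\1&-\mu\end{bmatrix},$$ and $\mathbf{0}$ denotes the $1\times3$ zero row vector. *)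

(* Defs.v *)
From HB Require Import structures.
From mathcomp Require Import all_boot all_order all_algebra.
From mathcomp Require Import all_classical all_reals all_analysis.

Set Implicit Arguments.
Unset Strict Implicit.
Unset Printing Implicit Defensive.

Import Order.TTheory GRing.Theory Num.Theory.
Import numFieldNormedType.Exports.

Local Open Scope classical_set_scope.
Local Open Scope ring_scope.

(* The library norm on 'rV[R]_d is the sup norm, so the Euclidean inner product
   is defined here; the Euclidean ||u||^2 is dotv u u.  Topology and
   differentiability do not depend on the choice of norm. *)
Definition dotv (R : realType) (d : nat) (u v : 'rV[R]_d) : R :=
  \sum_(i < d) u 0 i * v 0 i.

(* Meaningful only where f is differentiable ('d is a junk value elsewhere). *)
Definition grad (R : realType) (d : nat) (f : 'rV[R]_d -> R) (x : 'rV[R]_d) :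
  'rV[R]_d := \row_(i < d) 'd f x (delta_mx 0 i).

Definition C1 (R : realType) (d : nat) (f : 'rV[R]_d -> R) : Prop :=
  (forall x, differentiable f x) /\ continuous (grad f).

Definition local_minimizer (R : realType) (d : nat) (f : 'rV[R]_d -> R)
  (xs : 'rV[R]_d) : Prop := \forall y \near xs, f xs <= f y.

Definition RC (R : realType) (d : nat) (mu lambda : R) (f : 'rV[R]_d -> R)
  (xs : 'rV[R]_d) : Prop :=
  [/\ 0 < mu, 0 < lambda, local_minimizer f xs &
    forall x, dotv (grad f x) (x - xs) >=
      mu / 2 * dotv (grad f x) (grad f x) + lambda / 2 * dotv (x - xs) (x - xs)].

Definition posdefmx (R : realType) (n : nat) (Q : 'M[R]_n) : Prop :=
  Q^T = Q /\ forall v : 'cV[R]_n, v != 0 -> 0 < (v^T *m Q *m v) 0 0.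

Definition negsemidefmx (R : realType) (n : nat) (Q : 'M[R]_n) : Prop :=
  Q^T = Q /\ forall v : 'cV[R]_n, (v^T *m Q *m v) 0 0 <= 0.

Definition mx_of_rows (R : realType) (m n : nat) (s : seq (seq R)) :
  'M[R]_(m, n) := \matrix_(i < m, j < n) (nth [::] s i)`_j.

(* State-space model, with state (x_k, x_{k-1}, grad f x_{k-1}), input
   grad f x_k and output x_k, of the iteration
     x_{k+1} = (1 + beta) x_k - beta x_{k-1}
               - (alpha + gamma) grad f x_k + gamma grad f x_{k-1}. *)
Definition ssA (R : realType) (beta gamma : R) : 'M[R]_3 :=
  mx_of_rows 3 3 [:: [:: 1 + beta; - beta; gamma];
                     [:: 1;        0;      0];
                     [:: 0;        0;      0]].

Definition ssB (R : realType) (alpha gamma : R) : 'M[R]_(3, 1) :=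
  mx_of_rows 3 1 [:: [:: - (alpha + gamma)]; [:: 0]; [:: 1]].

Definition ssC (R : realType) : 'M[R]_(1, 3) :=
  mx_of_rows 1 3 [:: [:: 1; 0; 0]].

Definition ssD (R : realType) : 'M[R]_1 := 0.

Definition rcM (R : realType) (mu lambda : R) : 'M[R]_(1 + 1) :=
  mx_of_rows 2 2 [:: [:: - lambda; 1]; [:: 1; - mu]].

Definition lmi_lhs (R : realType) (mu lambda alpha beta gamma : R)
    (P : 'M[R]_3) (rho : R) : 'M[R]_(3 + 1) :=
  let A := ssA beta gamma in
  let B := ssB alpha gamma in
  let N : 'M[R]_(1 + 1, 3 + 1) := block_mx (ssC R) (ssD R) 0 1%:M in
  N^T *m rcM mu lambda *m N +
  block_mx (A^T *m P *m A - rho ^+ 2 *: P) (A^T *m P *m B)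
           (B^T *m P *m A)                 (B^T *m P *m B).

Definition Gamma2 (R : realType) (mu beta gamma : R) : R :=
  4 * (gamma - mu * beta).

Definition Gamma1 (R : realType) (mu lambda alpha beta gamma : R) : R :=
  2 * lambda * gamma * (alpha + gamma)
  - 2 * (1 + beta) * (alpha + 2 * gamma) + 2 * mu * (1 + beta) ^+ 2.

Definition Gamma0 (R : realType) (mu lambda alpha beta gamma : R) : R :=
  - lambda * (alpha ^+ 2 + 2 * alpha * gamma + 2 * gamma ^+ 2)
  + 2 * alpha * (1 + beta) + 4 * gamma * beta - 2 * mu * (1 + beta ^+ 2).

(* Main.v *)
Require Import Defs.
From HB Require Import structures.
From mathcomp Require Import all_boot all_order all_algebra.
From mathcomp Require Import all_classical all_reals all_analysis.
From mathcomp Require Import ring lra.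
Import Order.TTheory GRing.Theory Num.Theory.
Import numFieldNormedType.Exports.
Local Open Scope classical_set_scope.
Local Open Scope ring_scope.

(** The matrix inequality says that the storage function v^T P v dissipates along
    the recursion: after one step its value is at most rho^2 times the old one,
    minus the sector form -lambda x^2 + 2xu - mu u^2 of the regularity condition.
    The theorem is a discrete-time Kalman-Yakubovich-Popov lemma in which A has the
    eigenvalue 1 on the unit circle and (A, B) may be uncontrollable.

    From the matrix inequality to the polynomial.  The transfer function from u
    to x is N(z)/D(z) with N(z) = gamma - (alpha + gamma) z and
    D(z) = (z - 1)(z - beta), and for z = exp(i omega) the sector form on the
    complex pair (N(z), D(z)) equals P(cos omega).  The trajectory
    x_n = N(z) z^n, u_n = D(z) z^n merely rotates, so its storage does not change
    in one step, and the inequality leaves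
    P(cos omega) <= -(1 - rho^2) * storage < 0 ([lmi_frequency]).

    From the polynomial to the matrix inequality.  The output depends on the past
    only through x = x_k and e = beta (x_k - x_{k-1}) + gamma g_{k-1}, with
    x+ = x + e - (alpha + gamma) u,   e+ = beta e + kappa u,
    kappa = gamma - beta (alpha + gamma).
    It suffices to find a storage in (x, e) that strictly dissipates, to show that
    it is positive, and to add a small multiple of x_{k-1}^2 + g_{k-1}^2;
    strictness pays for this multiple and for a rho slightly below 1
    ([lmi_of_storage]).

    If kappa <> 0, the pair (x, u) is the image under (N, D) of a free signal w,
    and (x, e) corresponds to (w_n, w_{n+1}).  Storages then parametrize all Gram
    matrices, in (w_n, w_{n+1}, w_{n+2}), of the trigonometric polynomial
    -P(cos omega).  A positive definite one is given by
    -P(x) = (positive definite quadratic in x) + k (1 - x^2) with k > 0, since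
    1 - cos^2 omega = |z^2 - 1|^2 / 4 ([storage_controllable]).  If kappa = 0,
    N and D share the stable factor z - beta, the mode e decays by itself, and
    only a scalar problem remains; it is settled by P(-1) < 0
    ([storage_uncontrollable]).

    Positivity of the storage comes from the bounds on alpha and gamma.  The gain
    k = lambda / (1 + sqrt (1 - mu lambda)) lies on the boundary of the sector, so
    under u = k x the storage strictly decreases; the bounds are exactly the Jury
    stability conditions of that closed loop ([storage_pos]).  The square root is
    genuine because the regularity condition forces mu lambda <= 1. *)

(** * Quadratic forms *)

Definition qform2 {R : pzRingType} (p r s x e : R) : R :=
  p * x ^+ 2 + 2 * r * x * e + s * e ^+ 2.

Definition sector_form {R : pzRingType} (mu lambda x u : R) : R :=
  - lambda * x ^+ 2 + 2 * x * u - mu * u ^+ 2.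

(** One-step increment of the storage with coefficients p, r, s along the reduced
    state (x, e), plus the sector form; a storage strictly dissipates when this is
    negative definite in (x, e, u). *)
Definition dissipation_form {R : pzRingType}
    (mu lambda alpha beta gamma p r s x e u : R) : R :=
  qform2 p r s (x + e - (alpha + gamma) * u)
                 (beta * e + (gamma - beta * (alpha + gamma)) * u)
  - qform2 p r s x e + sector_form mu lambda x u.

(** Positivity on an interval is certified by a positive definite quadratic plus a
    positive multiple of 1 - x^2.  The multiplier (C - A)/2 balances the two
    diagonal coefficients, and then the discriminant condition is
    |B| < A + C, which is positivity at 1 and -1.  When it is not positive, the
    vertex of the parabola lies in [-1, 1], the quadratic is positive everywhere,
    and any small k works. *)
Lemma quad_pos_interval_multiplier (R : realFieldType) (A B C : R) :
  (forall x, -1 <= x <= 1 -> 0 < A * x ^+ 2 + B * x + C) ->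
  exists k, [/\ 0 < k, 0 < A + k & B ^+ 2 < 4 * (A + k) * (C - k)].
Proof.
move=> pos.
have pos1 : 0 < A + B + C by have := pos 1 _; lra.
have posN1 : 0 < A - B + C by have := pos (-1) _; lra.
have [ltAC|leCA] := ltP A C.
  exists ((C - A) / 2); split; [lra|lra|].
  have : 0 < (A + B + C) * (A - B + C) by apply: mulr_gt0.
  lra.
have A0 : 0 < A by lra.
have inI : -1 <= - B / (2 * A) <= 1.
  by rewrite ler_pdivlMr ?ler_pdivrMr; lra.
have D0 : 0 < 4 * A * C - B ^+ 2.
  have := pos _ inI.
  have -> : A * (- B / (2 * A)) ^+ 2 + B * (- B / (2 * A)) + C =
            (4 * A * C - B ^+ 2) / (4 * A) by field; lra.
  by rewrite pmulr_lgt0 // invr_gt0; lra.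
set D := 4 * A * C - B ^+ 2 in D0.
have M0 : 0 < 4 * (A - C) + 4 + D by lra.
(* Small enough that 4 k (A - C) + 4 k^2 < D, given k <= 1. *)
pose k := D / (4 * (A - C) + 4 + D).
have kM : k * (4 * (A - C) + 4 + D) = D by rewrite /k; field; lra.
have k0 : 0 < k by apply: divr_gt0.
have k1 : k <= 1 by rewrite /k ler_pdivrMr //; lra.
exists k; split=> //; first lra.
have kk : 0 <= k * (1 - k) by apply: mulr_ge0; lra.
have kD : 0 < k * D by apply: mulr_gt0.
rewrite -subr_gt0.
have -> : 4 * (A + k) * (C - k) - B ^+ 2 = 
   k * D + 4 * (k * (1 - k)) + (D - k * (4 * (A - C) + 4 + D)).
  by rewrite /D; ring.
by rewrite kM; lra.
Qed.

Lemma posdef2_coercive (R : realFieldType) (a b c : R) :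
  0 < a -> b ^+ 2 < 4 * a * c ->
  exists2 d, 0 < d &
    forall X Y, d * (X ^+ 2 + Y ^+ 2) <= a * X ^+ 2 + b * X * Y + c * Y ^+ 2.
Proof.
move=> a0 disc.
have c0 : 0 < c.
  have : 0 < 4 * a * c by apply: le_lt_trans disc; exact: sqr_ge0.
  by rewrite pmulr_rgt0 //; lra.
(* Determinant over trace, a lower bound for the smaller eigenvalue. *)
pose d := (4 * a * c - b ^+ 2) / (4 * (a + c)).
have dE : d * (4 * (a + c)) = 4 * a * c - b ^+ 2 by rewrite /d; field; lra.
have d0 : 0 < d by apply: divr_gt0; lra.
exists d => // X Y.
have ad0 : 0 < a - d.
  rewrite -(pmulr_lgt0 _ (_ : 0 < 4 * (a + c))); last lra.
  rewrite mulrBl dE.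
  have := sqr_ge0 b; have : 0 < a * a by apply: mulr_gt0.
  by lra.
rewrite -subr_ge0 -(pmulr_rge0 _ ad0).
have -> : (a - d) * (a * X ^+ 2 + b * X * Y + c * Y ^+ 2
                     - d * (X ^+ 2 + Y ^+ 2)) =
  ((a - d) * X + b / 2 * Y) ^+ 2 + (d * Y) ^+ 2 +
  ((4 * a * c - b ^+ 2) - d * (4 * (a + c))) / 4 * Y ^+ 2 by field.
by rewrite dE subrr !mul0r addr0 addr_ge0 ?sqr_ge0.
Qed.

Lemma cauchy_schwarz3 (R : realDomainType) (a b c x y z : R) :
  (a * x + b * y + c * z) ^+ 2 <=
  (a ^+ 2 + b ^+ 2 + c ^+ 2) * (x ^+ 2 + y ^+ 2 + z ^+ 2).
Proof.
rewrite -subr_ge0.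
have -> : (a ^+ 2 + b ^+ 2 + c ^+ 2) * (x ^+ 2 + y ^+ 2 + z ^+ 2)
  - (a * x + b * y + c * z) ^+ 2 =
  (a * y - b * x) ^+ 2 + (a * z - c * x) ^+ 2 + (b * z - c * y) ^+ 2 by ring.
by rewrite !addr_ge0 ?sqr_ge0.
Qed.

(** * Strictly dissipating storages *)

(** Gram matrix construction: W00 w0^2 + 2 W01 w0 w1 + W11 w1^2 is the storage for
    which minus the dissipation form is the chosen Gram form of -P(cos omega),
    namely the positive definite form of [quad_pos_interval_multiplier] with
    cos omega replaced by X = (w0 + w2)/2, where w0, w1, w2 stand for
    z^-1, 1, z, and with 1 - cos^2 omega replaced by the square of
    Y = (w2 - w0)/2. *)
Lemma storage_controllable (R : realType) (mu lambda alpha beta gamma : R) :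
  0 < alpha -> gamma - beta * (alpha + gamma) != 0 ->
  (forall x : R, -1 <= x <= 1 ->
     Gamma2 mu beta gamma * x ^+ 2 + Gamma1 mu lambda alpha beta gamma * x
       + Gamma0 mu lambda alpha beta gamma < 0) ->
  exists p r s d : R, 0 < d /\ forall x e u,
    dissipation_form mu lambda alpha beta gamma p r s x e u
      <= - d * (x ^+ 2 + e ^+ 2 + u ^+ 2).
Proof.
move=> alpha0 kappa0 freq.
pose A := - Gamma2 mu beta gamma.
pose B := - Gamma1 mu lambda alpha beta gamma.
pose C := - Gamma0 mu lambda alpha beta gamma.
have [k [k0 Ak0 disc]] : exists k,
    [/\ 0 < k, 0 < A + k & B ^+ 2 < 4 * (A + k) * (C - k)].
  apply: quad_pos_interval_multiplier => x /freq; rewrite /A /B /C; lra.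
have [d1 d10 coer] := posdef2_coercive _ _ _ _ Ak0 disc.
set kappa := gamma - beta * (alpha + gamma) in kappa0 *.
pose a := alpha + gamma.
pose W00 := - lambda * gamma ^+ 2 + 2 * gamma * beta - mu * beta ^+ 2
            + (A + 2 * k) / 4.
pose W01 := a - mu * (1 + beta) - B / 4.
pose W11 := mu - (A + 2 * k) / 4.
(* w0 = i x + j e and w1 = i x + l e invert x = gamma w0 - a w1 and
   e = kappa (w1 - w0), whose determinant is -alpha * kappa. *)
pose i := - alpha^-1.
pose j := - (a / (alpha * kappa)).
pose l := j + kappa^-1.
(* Bounds (x, e, u) in terms of (X, w1, Y), to turn coercivity in the latter
   into coercivity in the former. *)
pose K := (gamma ^+ 2 + a ^+ 2 + (- gamma) ^+ 2)
        + ((- kappa) ^+ 2 + kappa ^+ 2 + kappa ^+ 2)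
        + ((1 + beta) ^+ 2 + (- (1 + beta)) ^+ 2 + (1 - beta) ^+ 2) + 1.
have K0 : 0 < K by rewrite /K ltr_wpDl // !addr_ge0 ?sqr_ge0.
pose m := Num.min d1 k.
have m0 : 0 < m by rewrite lt_min d10 k0.
exists (W00 * i ^+ 2 + 2 * W01 * i * i + W11 * i ^+ 2).
exists (W00 * i * j + W01 * (i * l + i * j) + W11 * i * l).
exists (W00 * j ^+ 2 + 2 * W01 * j * l + W11 * l ^+ 2).
exists (m / K); split=> [|x e u]; first exact: divr_gt0.
pose w0 := i * x + j * e.
pose w1 := i * x + l * e.
pose w2 := u - beta * w0 + (1 + beta) * w1.
pose X := (w0 + w2) / 2.
pose Y := (w2 - w0) / 2.
have alphaN0 : alpha != 0 by lra.
have xE : x = gamma * X + (- a) * w1 + (- gamma) * Y.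
  rewrite /X /Y /w2 /w1 /w0 /l /i /j /a.
  by field; rewrite kappa0.
have eE : e = (- kappa) * X + kappa * w1 + kappa * Y.
  rewrite /X /Y /w2 /w1 /w0 /l.
  by field.
have uE : u = (1 + beta) * X + (- (1 + beta)) * w1 + (1 - beta) * Y.
  by rewrite /X /Y /w2; field.
have main : dissipation_form mu lambda alpha beta gamma
   (W00 * i ^+ 2 + 2 * W01 * i * i + W11 * i ^+ 2)
   (W00 * i * j + W01 * (i * l + i * j) + W11 * i * l)
   (W00 * j ^+ 2 + 2 * W01 * j * l + W11 * l ^+ 2) x e u =
  - ((A + k) * X ^+ 2 + B * X * w1 + (C - k) * w1 ^+ 2 + k * Y ^+ 2).
  have w0E : w0 = i * x + j * e by [].
  have w1E : w1 = i * x + l * e by [].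
  have w1S : i * (x + e - a * u) + j * (beta * e + kappa * u) = w1.
    rewrite /w1 /l /i /j /kappa /a; field.
    by rewrite alphaN0 kappa0.
  have w2S : i * (x + e - a * u) + l * (beta * e + kappa * u) = w2.
    rewrite /w2 /w1 /w0 /l /i /j /kappa /a; field.
    by rewrite alphaN0 kappa0.
  have formE y f : qform2 (W00 * i ^+ 2 + 2 * W01 * i * i + W11 * i ^+ 2)
     (W00 * i * j + W01 * (i * l + i * j) + W11 * i * l)
     (W00 * j ^+ 2 + 2 * W01 * j * l + W11 * l ^+ 2) y f =
     W00 * (i * y + j * f) ^+ 2
     + 2 * W01 * (i * y + j * f) * (i * y + l * f)
     + W11 * (i * y + l * f) ^+ 2.
    by rewrite /qform2; ring.
  rewrite /dissipation_form !formE -/kappa -/a w1S w2S -w0E -w1E.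
  rewrite {1}xE {1}uE.
  rewrite /sector_form (_ : w2 = X + Y); last by rewrite /X /Y; field.
  rewrite (_ : w0 = X - Y); last by rewrite /X /Y; field.
  rewrite /W00 /W01 /W11 /A /B /C /Gamma2 /Gamma1 /Gamma0 /a.
  by field.
rewrite {}main (mulNr (m / K)) lerN2.
have le1 : x ^+ 2 + e ^+ 2 + u ^+ 2 <= K * (X ^+ 2 + w1 ^+ 2 + Y ^+ 2).
  have hx := cauchy_schwarz3 _ gamma (- a) (- gamma) X w1 Y.
  have he := cauchy_schwarz3 _ (- kappa) kappa kappa X w1 Y.
  have hu := cauchy_schwarz3 _ (1 + beta) (- (1 + beta)) (1 - beta) X w1 Y.
  rewrite -xE in hx; rewrite -eE in he; rewrite -uE in hu.
  have := sqr_ge0 X; have := sqr_ge0 Y; have := sqr_ge0 w1.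
  rewrite sqrrN in hx.
  by rewrite /K; lra.
apply: (@le_trans _ _ (m * (X ^+ 2 + w1 ^+ 2 + Y ^+ 2))).
  by rewrite -mulrA ler_pM2l // ler_pdivrMl.
rewrite mulrDr lerD //.
  apply: le_trans (coer _ _); rewrite ler_wpM2r ?addr_ge0 ?sqr_ge0 //.
  by rewrite ge_min lexx.
by rewrite ler_wpM2r ?sqr_ge0 // ge_min lexx orbT.
Qed.

(** Without influence of u on e, a large weight s on e^2 absorbs all terms
    containing e, because |beta| < 1.  What remains is a form in (x, u) whose
    discriminant is a quadratic inequality in t = p (alpha + gamma); it is solved
    by the minimizer t = 1 - lambda (alpha + gamma)/2 exactly when P(-1) < 0. *)
Lemma storage_uncontrollable (R : realType) (mu lambda alpha beta gamma : R) :
  0 < lambda -> 0 < alpha + gamma -> -1 < beta < 1 ->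
  gamma = beta * (alpha + gamma) ->
  (forall x : R, -1 <= x <= 1 ->
     Gamma2 mu beta gamma * x ^+ 2 + Gamma1 mu lambda alpha beta gamma * x
       + Gamma0 mu lambda alpha beta gamma < 0) ->
  exists p r s d : R, 0 < d /\ forall x e u,
    dissipation_form mu lambda alpha beta gamma p r s x e u
      <= - d * (x ^+ 2 + e ^+ 2 + u ^+ 2).
Proof.
move=> lambda0.
set a := alpha + gamma => a0 /andP[betaN1 beta1] gammaE freq.
have alphaE : alpha = a - gamma by rewrite /a addrK.
have gap : 0 < lambda * a ^+ 2 - 4 * a + 4 * mu.
  have := freq (-1) _.
  have -> : Gamma2 mu beta gamma * (-1) ^+ 2
      + Gamma1 mu lambda alpha beta gamma * -1
      + Gamma0 mu lambda alpha beta gamma =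
    - ((1 + beta) ^+ 2 * (lambda * a ^+ 2 - 4 * a + 4 * mu)).
    rewrite /Gamma2 /Gamma1 /Gamma0 alphaE gammaE; ring.
  rewrite oppr_lt0 pmulr_rgt0; last by apply: exprn_gt0; lra.
  by apply; lra.
pose t := 1 - lambda * a / 2.
pose p := t / a.
have paE : p * a = t by rewrite /p; field; lra.
have [||d1 d10 coer] :=
  @posdef2_coercive _ lambda (- 2 * (1 - t)) (mu - t * a) => //.
  rewrite -subr_gt0 /t.
  suff -> : 4 * lambda * (mu - (1 - lambda * a / 2) * a)
     - (- 2 * (1 - (1 - lambda * a / 2))) ^+ 2 =
     lambda * (lambda * a ^+ 2 - 4 * a + 4 * mu) by apply: mulr_gt0.
  by field.
have b20 : 0 < 1 - beta ^+ 2.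
  have -> : 1 - beta ^+ 2 = (1 - beta) * (1 + beta) by ring.
  by apply: mulr_gt0; lra.
pose h := d1 / 2.
have h0 : 0 < h by rewrite /h; lra.
(* The last summand completes the squares of the cross terms x e and e u. *)
pose s := (p + h + (p ^+ 2 + t ^+ 2) / h) / (1 - beta ^+ 2).
have sE : s * (1 - beta ^+ 2) = p + h + (p ^+ 2 + t ^+ 2) / h.
  by rewrite /s; field; lra.
exists p, 0, s, h; split=> // x e u.
have split_sq : h * (x ^+ 2 + u ^+ 2) + (p ^+ 2 + t ^+ 2) / h * e ^+ 2 =
   h^-1 * ((h * x - p * e) ^+ 2 + (h * u + t * e) ^+ 2)
   + 2 * p * x * e - 2 * t * e * u by field; lra.
have sq0 : 0 <= h^-1 * ((h * x - p * e) ^+ 2 + (h * u + t * e) ^+ 2).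
  by rewrite mulr_ge0 ?invr_ge0 ?addr_ge0 ?sqr_ge0 // ltW.
have := coer x u.
have -> : dissipation_form mu lambda alpha beta gamma p 0 s x e u =
  - (lambda * x ^+ 2 + -2 * (1 - t) * x * u + (mu - t * a) * u ^+ 2)
  + (2 * p * x * e - 2 * t * e * u)
  - (s * (1 - beta ^+ 2) - p) * e ^+ 2.
  rewrite /dissipation_form /qform2 /sector_form -/a gammaE subrr mul0r -paE.
  by ring.
rewrite sE.
have -> : d1 = 2 * h by rewrite /h; field.
lra.
Qed.

(** * Positivity of the storage *)

(** P, Q, S are the values of a quadratic form on a vector v and its image Fv
    under an operator with F^2 + b F + c = 0, so that F sends (s, t) to
    (-c t, s - b t) in the family (v, Fv).  If the form decreases along F and the
    Jury conditions hold, then the form is positive at v.  The vectors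
    v and Fv may be dependent, so this covers eigenvectors of F as well. *)
Lemma lyapunov_jury (R : realFieldType) (b c P Q S : R) :
  c < 1 -> `|b| < 1 + c ->
  (forall s t, qform2 P Q S (- c * t) (s - b * t) <= qform2 P Q S s t) ->
  S < P -> 0 < P.
Proof.
move=> c1; rewrite ltr_norml => /andP[bl bu] decr ltSP.
suff S0 : 0 <= S by lra.
(* At t = 1, s = c and s = -c, all terms in P cancel. *)
have h1 := decr c 1; have h2 := decr (- c) 1.
rewrite -subr_ge0 in h1; rewrite -subr_ge0 in h2.
have q1 := mulr_ge0 (_ : 0 <= 1 + c + b) h1.
have q2 := mulr_ge0 (_ : 0 <= 1 + c - b) h2.
have /q1 {}q1 : 0 <= 1 + c + b by lra.
have /q2 {}q2 : 0 <= 1 + c - b by lra.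
have den : 0 < 2 * (1 - c) * (1 + c - b) * (1 + c + b).
  by rewrite !mulr_gt0 //; lra.
rewrite -(pmulr_rge0 _ den).
suff -> : 2 * (1 - c) * (1 + c - b) * (1 + c + b) * S =
  (1 + c + b) * (qform2 P Q S c 1 - qform2 P Q S (- c * 1) (c - b * 1))
  + (1 + c - b) *
    (qform2 P Q S (- c) 1 - qform2 P Q S (- c * 1) (- c - b * 1))
  by apply: addr_ge0.
rewrite /qform2; ring.
Qed.

(** Under the feedback u = k x with k in the sector, the sector form is
    nonnegative, so the storage strictly decreases along the closed loop, whose
    characteristic polynomial is z^2 + b z + c with b and c as below.  The last
    three bounds on k are its Jury conditions. *)
Lemma storage_pos (R : realFieldType)
    (mu lambda alpha beta gamma k p r s d : R) :
  0 < d ->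
  (forall x e u, dissipation_form mu lambda alpha beta gamma p r s x e u
      <= - d * (x ^+ 2 + e ^+ 2 + u ^+ 2)) ->
  lambda - 2 * k + mu * k ^+ 2 <= 0 ->
  beta < 1 + gamma * k -> 0 < alpha * k ->
  k * (alpha + 2 * gamma) < 2 * (1 + beta) ->
  forall x e, (x != 0) || (e != 0) -> 0 < qform2 p r s x e.
Proof.
move=> d0 diss sector hc hk1 hk2 x e xe0.
pose a := alpha + gamma.
pose kappa := gamma - beta * a.
pose b := k * a - 1 - beta.
pose c := beta - k * gamma.
have decr y f : qform2 p r s (y + f - a * (k * y)) (beta * f + kappa * (k * y))
   <= qform2 p r s y f - d * (y ^+ 2 + f ^+ 2).
  have := diss y f (k * y); rewrite /dissipation_form -/a -/kappa.
  have -> : sector_form mu lambda y (k * y) =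
     - ((lambda - 2 * k + mu * k ^+ 2) * y ^+ 2) by rewrite /sector_form; ring.
  have : 0 <= - (lambda - 2 * k + mu * k ^+ 2) * y ^+ 2.
    by rewrite mulr_ge0 ?sqr_ge0 //; lra.
  have : 0 <= d * (k * y) ^+ 2 by rewrite mulr_ge0 ?sqr_ge0 // ltW.
  by lra.
pose x1 := x + e - a * (k * x).
pose e1 := beta * e + kappa * (k * x).
pose Q := p * x * x1 + r * (x * e1 + x1 * e) + s * e * e1.
have comb i j : qform2 p r s (i * x + j * x1) (i * e + j * e1) =
   qform2 (qform2 p r s x e) Q (qform2 p r s x1 e1) i j.
  by rewrite /Q /qform2; ring.
have pos_sq : 0 < x ^+ 2 + e ^+ 2.
  have [x0|e0] := orP xe0.
    by rewrite ltr_wpDr ?sqr_ge0 // exprn_even_gt0.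
  by rewrite ltr_wpDl ?sqr_ge0 // exprn_even_gt0.
apply: (@lyapunov_jury _ b c _ Q (qform2 p r s x1 e1)).
- by rewrite /c; lra.
- by rewrite ltr_norml /b /c /a; apply/andP; split; lra.
- move=> i j; rewrite -!comb.
  have := decr (i * x + j * x1) (i * e + j * e1).
  have -> : i * x + j * x1 + (i * e + j * e1) - a * (k * (i * x + j * x1)) =
     - c * j * x + (i - b * j) * x1.
    by rewrite /x1 /e1 /b /c /kappa; ring.
  have -> : beta * (i * e + j * e1) + kappa * (k * (i * x + j * x1)) =
     - c * j * e + (i - b * j) * e1.
    by rewrite /x1 /e1 /b /c /kappa; ring.
  move=> h; apply: (le_trans h); rewrite lerBlDr lerDl.
  by rewrite mulr_ge0 ?addr_ge0 ?sqr_ge0 // ltW.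
- apply: (le_lt_trans (decr x e)).
  by rewrite ltrBlDr ltrDl mulr_gt0.
Qed.

(** At the point xs + (1, ..., 1), where every coordinate of the displacement is
    nonzero, mu lambda > 1 would violate the condition coordinatewise: the
    quadratic mu/2 g^2 - g + lambda/2 would then have no real root. *)
Lemma regularity_constants (R : realType) (d : nat) (f : 'rV[R]_d -> R)
    (xs : 'rV[R]_d) (mu lambda : R) :
  (0 < d)%N -> RC mu lambda f xs -> mu * lambda <= 1.
Proof.
case: d f xs => // d f xs _ [mu0 lambda0 _ rc].
rewrite leNgt; apply/negP => gt1.
have := rc (xs + const_mx 1).
rewrite addrAC subrr add0r; apply/negP; rewrite -ltNge.
rewrite /dotv !mulr_sumr -big_split /=.
apply: ltr_sum => [|i _]; last first.
  set g := fun_of_matrix (grad _ _) _ _; rewrite mxE.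
  have : 0 < mu * (mu / 2 * (g * g) + lambda / 2 * (1 * 1) - g * 1).
    have -> : mu * (mu / 2 * (g * g) + lambda / 2 * (1 * 1) - g * 1) =
       ((mu * g - 1) ^+ 2 + (mu * lambda - 1)) / 2 by field.
    have := sqr_ge0 (mu * g - 1); lra.
  by rewrite pmulr_rgt0 // subr_gt0.
by apply/hasP; exists ord0; rewrite ?mem_index_enum.
Qed.

(** For mu > 0 this gain is the smaller root (1 - sqrt (1 - mu lambda))/mu of the sector
    polynomial, rationalized. *)
Lemma boundary_gain (R : rcfType) (mu lambda : R)
    (k := lambda / (1 + Num.sqrt (1 - mu * lambda))) :
  mu * lambda <= 1 -> lambda - 2 * k + mu * k ^+ 2 = 0.
Proof.
move=> h; rewrite /k; set sg := Num.sqrt _.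
have sg0 : 0 <= sg by apply: sqrtr_ge0.
have sgE : sg ^+ 2 = 1 - mu * lambda by rewrite sqr_sqrtr //; lra.
have -> : lambda - 2 * (lambda / (1 + sg)) + mu * (lambda / (1 + sg)) ^+ 2 =
  lambda * (sg ^+ 2 - (1 - mu * lambda)) / (1 + sg) ^+ 2 by field; lra.
by rewrite sgE subrr mulr0 mul0r.
Qed.

(** * The matrix inequality as a dissipation inequality *)

Definition qform {R : pzRingType} {n} (P : 'M[R]_n) (v : 'cV[R]_n) : R :=
  (v^T *m P *m v) 0 0.

Definition col3 {R : realType} (a b c : R) : 'cV[R]_3 :=
  mx_of_rows 3 1 [:: [:: a]; [:: b]; [:: c]].

Lemma col3_eta (R : realType) (v : 'cV[R]_3) :
  v = col3 (v 0 0) (v 1 0) (v 2%:R 0).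
Proof.
apply/colP=> -[[|[|[|//]]] lti]; rewrite mxE /=; congr (v _ _);
  exact: val_inj.
Qed.

Lemma col3_eq0 (R : realType) (a b c : R) :
  (col3 a b c == 0) = [&& a == 0, b == 0 & c == 0].
Proof.
apply/eqP/and3P => [/colP h|[/eqP-> /eqP-> /eqP->]].
  by split; apply/eqP; [have := h 0|have := h 1|have := h 2%:R]; rewrite !mxE.
by apply/colP=> -[[|[|[|//]]] lti]; rewrite !mxE.
Qed.

Lemma qform_sym3 (R : realType) (p00 p01 p02 p11 p12 p22 a b c : R) :
  qform (mx_of_rows 3 3 [:: [:: p00; p01; p02];
                            [:: p01; p11; p12];
                            [:: p02; p12; p22]]) (col3 a b c) =
  p00 * a ^+ 2 + p11 * b ^+ 2 + p22 * c ^+ 2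
  + 2 * (p01 * a * b + p02 * a * c + p12 * b * c).
Proof.
rewrite /qform !mxE !big_ord_recl big_ord0 !mxE /= !big_ord_recl !big_ord0.
rewrite !mxE /=; ring.
Qed.

Lemma ss_step (R : realType) (alpha beta gamma x x0 g0 u : R) :
  ssA beta gamma *m col3 x x0 g0 + ssB alpha gamma *m u%:M =
  col3 ((1 + beta) * x - beta * x0 + gamma * g0 - (alpha + gamma) * u) x u.
Proof.
apply/colP=> -[[|[|[|//]]] lti];
  rewrite !mxE !big_ord_recl !big_ord0 !mxE /=; ring.
Qed.

Lemma qform_rcM (R : realType) (mu lambda x u : R) :
  qform (rcM mu lambda) (col_mx x%:M u%:M) = sector_form mu lambda x u.
Proof.
have -> : col_mx (x%:M : 'M[R]_1) (u%:M : 'M[R]_1) =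
  mx_of_rows 2 1 [:: [:: x]; [:: u]].
  apply/colP=> i; rewrite !mxE.
  by case: splitP => t; rewrite ord1 mxE => ->.
rewrite /qform !mxE !big_ord_recl big_ord0 !mxE /= !big_ord_recl !big_ord0.
rewrite !mxE /= /sector_form; ring.
Qed.

Lemma qform_lmi (R : realType) (mu lambda alpha beta gamma : R)
    (P : 'M[R]_3) (rho x x0 g0 u : R) :
  qform (lmi_lhs mu lambda alpha beta gamma P rho)
        (col_mx (col3 x x0 g0) u%:M) =
  sector_form mu lambda x u
  + qform P (col3 ((1 + beta) * x - beta * x0 + gamma * g0
                   - (alpha + gamma) * u) x u)
  - rho ^+ 2 * qform P (col3 x x0 g0).
Proof.
rewrite -ss_step; set xi := col3 x x0 g0; set w := u%:M.
rewrite /lmi_lhs; set A := ssA _ _; set B := ssB _ _; set N := block_mx _ _ _ _.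
have NE : N *m col_mx xi w = col_mx x%:M w.
  rewrite mul_block_col /ssD !mul0mx mul1mx add0r addr0; congr col_mx.
  apply/matrixP=> i j; rewrite !ord1.
  by rewrite !mxE !big_ord_recl big_ord0 !mxE /=; ring.
rewrite -(qform_rcM R mu lambda) -NE /qform.
set M := rcM _ _; set z := col_mx xi w.
rewrite mulmxDr mulmxDl mxE !trmx_mul !mulmxA -!addrA; congr (_ + _).
rewrite /z tr_col_mx mul_row_block mul_row_col !linearD /=.
rewrite !trmx_mul !(mulmxDl, mulmxDr, mulmxBl, mulmxBr) !mulmxA.
rewrite mulmxN mulNmx -scalemxAr -scalemxAl.
move: (xi^T *m _ *m _ *m A *m xi) (w^T *m _ *m _ *m A *m xi)
      (xi^T *m _ *m _ *m B *m w) (w^T *m _ *m _ *m B *m w)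
      (xi^T *m P *m xi) => T1 T2 T3 T4 T5.
by rewrite !mxE; ring.
Qed.

Lemma lmi_sym (R : realType) (mu lambda alpha beta gamma : R)
    (P : 'M[R]_3) (rho : R) : P^T = P ->
  (lmi_lhs mu lambda alpha beta gamma P rho)^T
  = lmi_lhs mu lambda alpha beta gamma P rho.
Proof.
move=> PT.
have MT : (rcM mu lambda)^T = rcM mu lambda.
  by apply/matrixP=> -[[|[|//]] ?] -[[|[|//]] ?]; rewrite !mxE.
rewrite /lmi_lhs; set A := ssA _ _; set B := ssB _ _; set N := block_mx _ _ _ _.
rewrite linearD /= tr_block_mx linearD /= linearN /= linearZ /=.
by rewrite !trmx_mul !trmxK PT MT !mulmxA.
Qed.

(** * Necessity of the frequency condition *)

(** Multiplying v + i w by c + i s of modulus one preserves the Hermitian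
    extension of the form, whose value is the sum of the values on the real and
    imaginary parts. *)
Lemma qform_rotation (R : comPzRingType) n (P : 'M[R]_n) (v w : 'cV[R]_n)
    (c s : R) : c ^+ 2 + s ^+ 2 = 1 ->
  qform P (c *: v - s *: w) + qform P (s *: v + c *: w)
  = qform P v + qform P w.
Proof.
move=> cs1; rewrite /qform -scaleNr !linearD /= !linearZ /=.
rewrite !(mulmxDl, mulmxDr) -!(scalemxAl, scalemxAr).
move: (v^T *m P *m v) (v^T *m P *m w) (w^T *m P *m v) (w^T *m P *m w)
  => T1 T2 T3 T4.
have s2 : s ^+ 2 = 1 - c ^+ 2 by rewrite -cs1 addrC addKr.
by rewrite !mxE; ring: s2.
Qed.

Lemma posdefmx_qform_ge0 (R : realType) n (P : 'M[R]_n) (v : 'cV[R]_n) :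
  posdefmx P -> 0 <= qform P v.
Proof.
move=> [_ Ppos]; have [->|v0] := eqVneq v 0; last exact/ltW/Ppos.
by rewrite /qform mulmx0 mxE.
Qed.

(** The trajectory x_n = N(z) z^n, u_n = D(z) z^n on the unit circle is split into
    real and imaginary parts, to which the matrix inequality applies separately.
    Its storage is nonzero since |N(z)| >= alpha there. *)
Lemma lmi_frequency (R : realType) (mu lambda alpha beta gamma : R)
    (P : 'M[R]_3) (rho : R) :
  0 < alpha -> 0 < gamma -> posdefmx P -> 0 < rho < 1 ->
  negsemidefmx (lmi_lhs mu lambda alpha beta gamma P rho) ->
  forall x : R, -1 <= x <= 1 ->
     Gamma2 mu beta gamma * x ^+ 2 + Gamma1 mu lambda alpha beta gamma * x
       + Gamma0 mu lambda alpha beta gamma < 0.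
Proof.
move=> alpha0 gamma0 Ppd /andP[rho0 rho1] [_ lmi] c /andP[cN1 c1].
pose a := alpha + gamma.
pose s := Num.sqrt (1 - c ^+ 2).
have cs1 : c ^+ 2 + s ^+ 2 = 1.
  rewrite sqr_sqrtr; first by rewrite addrC subrK.
  by rewrite subr_ge0 expr2; nra.
(* Output and input generated by a latent signal w; the real and imaginary parts
   of z^-1, 1, z, z^2 are (c, 1, c, 2c^2 - 1) and (-s, 0, s, 2cs). *)
pose X (w0 w1 : R) := gamma * w0 - a * w1.
pose U (w0 w1 w2 : R) := beta * w0 - (1 + beta) * w1 + w2.
pose xi (wm w0 w1 : R) := col3 (X w0 w1) (X wm w0) (U wm w0 w1).
have bal wm w0 w1 w2 :
    sector_form mu lambda (X w0 w1) (U w0 w1 w2) + qform P (xi w0 w1 w2)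
    <= rho ^+ 2 * qform P (xi wm w0 w1).
  have := lmi (col_mx (xi wm w0 w1) (U w0 w1 w2)%:M).
  rewrite -/(qform _ _) qform_lmi -/a subr_le0.
  suff -> : (1 + beta) * X w0 w1 - beta * X wm w0 + gamma * U wm w0 w1
     - a * U w0 w1 w2 = X w1 w2 by [].
  by rewrite /X /U; ring.
have s2 : s ^+ 2 = 1 - c ^+ 2 by rewrite -cs1 addrC addKr.
have reE : xi 1 c (2 * c ^+ 2 - 1) = c *: xi c 1 c - s *: xi (- s) 0 s.
  apply/colP=> -[[|[|[|//]]] lti]; rewrite !mxE /= /X /U; ring: s2.
have imE : xi 0 s (2 * c * s) = s *: xi c 1 c + c *: xi (- s) 0 s.
  apply/colP=> -[[|[|[|//]]] lti]; rewrite !mxE /= /X /U; ring: s2.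
have rot := qform_rotation _ _ P (xi c 1 c) (xi (- s) 0 s) c s cs1.
rewrite -reE -imE in rot.
have re := bal c 1 c (2 * c ^+ 2 - 1).
have im := bal (- s) 0 s (2 * c * s).
have -> : Gamma2 mu beta gamma * c ^+ 2
    + Gamma1 mu lambda alpha beta gamma * c
    + Gamma0 mu lambda alpha beta gamma =
  sector_form mu lambda (X 1 c) (U 1 c (2 * c ^+ 2 - 1))
  + sector_form mu lambda (X 0 s) (U 0 s (2 * c * s)).
  by rewrite /sector_form /X /U /Gamma2 /Gamma1 /Gamma0 /a; ring: s2.
have Vc0 := posdefmx_qform_ge0 _ _ _ (xi c 1 c) Ppd.
have Vs0 := posdefmx_qform_ge0 _ _ _ (xi (- s) 0 s) Ppd.
have V0 : 0 < qform P (xi c 1 c) + qform P (xi (- s) 0 s).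
  have [xi0|/(proj2 Ppd) Vc] := eqVneq (xi c 1 c) 0; last first.
    by rewrite -/(qform _ _) in Vc; lra.
  have [eta0|/(proj2 Ppd) Vs] := eqVneq (xi (- s) 0 s) 0; last first.
    by rewrite -/(qform _ _) in Vs; lra.
  move/eqP: xi0; rewrite col3_eq0 => /and3P[/eqP xc _ _].
  move/eqP: eta0; rewrite col3_eq0 => /and3P[/eqP xs _ _].
  have a0 : a != 0 by rewrite /a; lra.
  move: xs; rewrite /X mulr0 add0r => /eqP.
  rewrite oppr_eq0 mulf_eq0 (negPf a0) /= => /eqP s0.
  have gammaE : gamma = a * c by move: xc; rewrite /X; lra.
  have : 0 < alpha * (alpha + 2 * gamma) by apply: mulr_gt0; lra.
  have -> : alpha * (alpha + 2 * gamma) = a ^+ 2 - gamma ^+ 2.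
    by rewrite /a; ring.
  have c2 : c ^+ 2 = 1 by move: cs1; rewrite s0 expr0n addr0.
  by rewrite [in X in _ - X]gammaE exprMn c2 mulr1 subrr ltxx.
have rho2 : 0 < 1 - rho ^+ 2.
  have -> : 1 - rho ^+ 2 = (1 - rho) * (1 + rho) by ring.
  by apply: mulr_gt0; lra.
have := mulr_gt0 rho2 V0.
rewrite mulrBl mul1r mulrDr; lra.
Qed.

(** * From a storage to the matrix inequality *)

Lemma qform2_le (R : realDomainType) (p r s x e : R) :
  qform2 p r s x e <= (`|p| + `|r| + `|s|) * (x ^+ 2 + e ^+ 2).
Proof.
have hp : p * x ^+ 2 <= `|p| * x ^+ 2 by rewrite ler_wpM2r ?sqr_ge0 ?ler_norm.
have hs : s * e ^+ 2 <= `|s| * e ^+ 2 by rewrite ler_wpM2r ?sqr_ge0 ?ler_norm.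
have hr : 2 * r * x * e <= `|r| * (x ^+ 2 + e ^+ 2).
  have [r0|r0] := ger0P r.
    have := mulr_ge0 r0 (sqr_ge0 (x - e)); lra.
  have := mulr_ge0 (_ : 0 <= - r) (sqr_ge0 (x + e)).
  by move=> /(_ _); rewrite oppr_ge0 => /(_ (ltW r0)); lra.
have := mulr_ge0 (normr_ge0 p) (sqr_ge0 e).
have := mulr_ge0 (normr_ge0 s) (sqr_ge0 x).
by rewrite /qform2; lra.
Qed.

(** P is the storage pulled back to the full state, plus d/2 (x0^2 + g0^2).  The
    second summand makes P definite: it controls x0 and g0, and where they vanish
    e = beta x, so the storage controls x.  After one step it becomes
    d/2 (x^2 + u^2), which together with the loss from rho < 1 fits within the
    dissipation margin d. *)
Lemma lmi_of_storage (R : realType)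
    (mu lambda alpha beta gamma p r s d : R) :
  0 < gamma -> 0 < d ->
  (forall x e, (x != 0) || (e != 0) -> 0 < qform2 p r s x e) ->
  (forall x e u, dissipation_form mu lambda alpha beta gamma p r s x e u
      <= - d * (x ^+ 2 + e ^+ 2 + u ^+ 2)) ->
  exists (P : 'M[R]_3) (rho : R),
    [/\ posdefmx P, 0 < rho < 1
      & negsemidefmx (lmi_lhs mu lambda alpha beta gamma P rho)].
Proof.
move=> gamma0 d0 pos diss.
pose E (x x0 g0 : R) := beta * (x - x0) + gamma * g0.
pose P : 'M[R]_3 := mx_of_rows 3 3
  [:: [:: p + 2 * r * beta + s * beta ^+ 2;
          - (r * beta + s * beta ^+ 2); (r + s * beta) * gamma];
      [:: - (r * beta + s * beta ^+ 2);
          s * beta ^+ 2 + d / 2; - (s * beta * gamma)];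
      [:: (r + s * beta) * gamma;
          - (s * beta * gamma); s * gamma ^+ 2 + d / 2]].
have PT : P^T = P.
  by apply/matrixP=> -[[|[|[|//]]] ?] -[[|[|[|//]]] ?]; rewrite !mxE.
have PE x x0 g0 : qform P (col3 x x0 g0) =
    qform2 p r s x (E x x0 g0) + d / 2 * (x0 ^+ 2 + g0 ^+ 2).
  by rewrite qform_sym3 /qform2 /E; field.
pose K := `|p| + `|r| + `|s|.
have K0 : 0 <= K by rewrite !addr_ge0.
(* Chosen so that 1 - (1 - t)^2 <= 2 t and 2 t K <= d / 2. *)
pose t := d / (4 * (K + d)).
have tE : t * (4 * (K + d)) = d by rewrite /t; field; lra.
have t0 : 0 < t by apply: divr_gt0; lra.
have t4 : t <= 1 / 4 by rewrite /t ler_pdivrMr; lra.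
exists P, (1 - t); split; last split; first split=> // v.
- rewrite (col3_eta _ v) col3_eq0 -/(qform _ _) PE.
  move: (v 0 0) (v 1 0) (v 2%:R 0) => x x0 g0 nz.
  have sq0 := addr_ge0 (sqr_ge0 x0) (sqr_ge0 g0).
  have [/eqP sq|sqN0] := boolP (x0 ^+ 2 + g0 ^+ 2 == 0).
    move/eqP: sq; rewrite paddr_eq0 ?sqr_ge0 // !sqrf_eq0.
    move=> /andP[/eqP x00 /eqP g00].
    rewrite x00 g00 expr0n /= addr0 mulr0 addr0; apply: pos.
    by move: nz; rewrite x00 g00 eqxx !andbT => ->.
  have sqp : 0 < d / 2 * (x0 ^+ 2 + g0 ^+ 2).
    by rewrite mulr_gt0 ?lt_def ?sqN0 //; lra.
  rewrite ltr_wpDl //.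
  have [nz'|] := boolP ((x != 0) || (E x x0 g0 != 0)); first exact/ltW/pos.
  rewrite negb_or !negbK => /andP[/eqP-> /eqP->].
  by rewrite /qform2; lra.
- by apply/andP; split; lra.
- exact: lmi_sym.
move=> v; rewrite -/(qform _ _).
rewrite -[v]vsubmxK (col3_eta _ (usubmx v)) [dsubmx v]mx11_scalar qform_lmi.
move: (usubmx v 0 0) (usubmx v 1 0) (usubmx v 2%:R 0) (dsubmx v 0 0).
move=> x x0 g0 u; rewrite !PE.
set e := E x x0 g0.
rewrite (_ : (1 + beta) * x - _ + _ - _ = x + e - (alpha + gamma) * u);
  last by rewrite /e /E; ring.
rewrite (_ : E _ x u = beta * e + (gamma - beta * (alpha + gamma)) * u);
  last by rewrite /E; ring.
have := diss x e u; rewrite /dissipation_form.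
set V1 := qform2 p r s (_ - _) _; set V := qform2 p r s x e => dis.
have VK : V <= K * (x ^+ 2 + e ^+ 2) by apply: qform2_le.
have loss : (1 - (1 - t) ^+ 2) * V <= d / 2 * (x ^+ 2 + e ^+ 2).
  have w0 : 0 <= 1 - (1 - t) ^+ 2.
    have -> : 1 - (1 - t) ^+ 2 = t * (2 - t) by ring.
    by apply: mulr_ge0; lra.
  apply: (le_trans (ler_wpM2l w0 VK)); rewrite mulrA.
  rewrite ler_wpM2r ?addr_ge0 ?sqr_ge0 //.
  have := mulr_ge0 (sqr_ge0 t) K0; have := mulr_gt0 t0 d0.
  by move: tE; lra.
have : 0 <= (1 - t) ^+ 2 * (d / 2 * (x0 ^+ 2 + g0 ^+ 2)).
  by rewrite mulr_ge0 ?sqr_ge0 // mulr_ge0 ?addr_ge0 ?sqr_ge0 //; lra.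
have := mulr_ge0 (ltW d0) (sqr_ge0 e); have := mulr_ge0 (ltW d0) (sqr_ge0 u).
by move: loss dis; lra.
Qed.

Theorem theorem2 (R : realType) (d : nat) (hd : (0 < d)%N)
  (f : 'rV[R]_d -> R) (xs : 'rV[R]_d) (mu lambda alpha beta gamma : R)
  (hC1 : C1 f) (hRC : RC mu lambda f xs)
  (hgamma : 0 < gamma < (1 + beta) * (1 + Num.sqrt (1 - mu * lambda)) / lambda)
  (halpha : 0 < alpha <
     2 * (1 + beta) * (1 + Num.sqrt (1 - mu * lambda)) / lambda - 2 * gamma)
  (hbeta : -1 < beta < 1) :
  (exists (P : 'M[R]_3) (rho : R),
     [/\ posdefmx P, 0 < rho < 1
       & negsemidefmx (lmi_lhs mu lambda alpha beta gamma P rho)])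
  <->
  (forall x : R, -1 <= x <= 1 ->
     Gamma2 mu beta gamma * x ^+ 2 + Gamma1 mu lambda alpha beta gamma * x
       + Gamma0 mu lambda alpha beta gamma < 0).

Proof.
have [mu0 lambda0 _ _] := hRC.
have mulambda := regularity_constants _ _ _ _ _ _ hd hRC.
have [gamma0 gamma_lt] := andP hgamma.
have [alpha0 alpha_lt] := andP halpha.
split=> [[P [rho [Ppd rho01 lmi]]]|freq]; first exact: lmi_frequency lmi.
have [p [r [s [delta [delta0 diss]]]]] : exists p r s delta : R, 0 < delta /\
    forall x e u, dissipation_form mu lambda alpha beta gamma p r s x e u
      <= - delta * (x ^+ 2 + e ^+ 2 + u ^+ 2).
  have [kappa0|kappaN0] := eqVneq (gamma - beta * (alpha + gamma)) 0.
    apply: storage_uncontrollable => //; first lra.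
    by apply/eqP; rewrite -subr_eq0 kappa0.
  exact: storage_controllable.
apply: (lmi_of_storage _ _ _ _ _ _ _ _ _ _ gamma0 delta0 _ diss).
have gainE := boundary_gain _ _ _ mulambda.
set sg := Num.sqrt _ in gainE gamma_lt alpha_lt.
have sg0 : 0 <= sg by apply: sqrtr_ge0.
pose k := lambda / (1 + sg).
have k0 : 0 < k by apply: divr_gt0; lra.
have kE z : (z * (1 + sg) / lambda) * k = z by rewrite /k; field; lra.
apply: (storage_pos _ _ _ _ _ _ k _ _ _ _ delta0 diss).
- by rewrite gainE.
- have := mulr_gt0 gamma0 k0; lra.
- exact: mulr_gt0.
- have : (alpha + 2 * gamma) * k <
      (2 * (1 + beta) * (1 + sg) / lambda) * k by rewrite ltr_pM2r //; lra.
  by rewrite kE; lra.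
Qed.
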